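(* Fix an integer $n>0$ and a sign pattern $\epsilon=(\epsilon_1,\ldots,\epsilon_{n-1})$ with each $\epsilon_r\in\{1,-1\}$; set $\epsilon_0:=1$. Let the square matrix $A\in\mathbb{R}^{n\times n}$ be SSR$_{n-1}(\epsilon)$. Then $S^+(A\mathbf{x}_0)\leq S^-(\mathbf{x}_0)$ for every vector $\mathbf{x}_0\in\mathbb{R}^n$ with no zero entries and at least two successive coordinates which have the same sign. Further, for every such $\mathbf{x}_0$, if $A\mathbf{x}_0\neq\mathbf{0}$ and $S^+(A\mathbf{x}_0)=S^-(\mathbf{x}_0)=r$ for some $0\leq r\leq n-2$, then the sign of the first (respectively last) component of $A\mathbf{x}_0$ (if this component is zero, the unique sign given to it in determining $S^+(A\mathbf{x}_0)$) equals $\epsilon_r\epsilon_{r+1}$ times the sign of the first (respectively last) component of $\mathbf{x}_0$.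
   Context: Sign changes: for $\mathbf{x}=(x_1,\ldots,x_n)^T\in\mathbb{R}^n$, $S^-(\mathbf{x})$ is the number of sign changes in the sequence $x_1,\ldots,x_n$ after discarding all zero entries, with $S^-(\mathbf{0}):=0$. For $\mathbf{x}\neq\mathbf{0}$, $S^+(\mathbf{x})$ is the maximum possible number of sign changes in the sequence obtained by assigning to each zero entry of $\mathbf{x}$ a value $1$ or $-1$; and $S^+(\mathbf{0}):=n$ for $\mathbf{0}\in\mathbb{R}^n$. If the first (or last) entry of a non-zero vector is zero, its ''unique sign given in determining $S^+$'' is the sign it receives in any assignment achieving the maximum number of sign changes. SSR$_k(\epsilon)$: given integers $m,n\geq k\geq 1$ and $\epsilon=(\epsilon_1,\ldots,\epsilon_k)\in\{1,-1\}^k$, a real $m\times n$ matrix $A$ is SSR$_k(\epsilon)$ (strictly sign regular of order $k$ with sign pattern $\epsilon$) if for each $1\leq r\leq k$ every $r\times r$ minor of $A$ is non-zero and has sign $\epsilon_r$. *)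

(* Defs.v *)
From mathcomp Require Import all_boot all_order all_algebra.
From mathcomp Require Import reals.
From mathcomp.real_closed Require Import qe_rcf_th.

Set Implicit Arguments.
Unset Strict Implicit.
Unset Printing Implicit Defensive.

Import Order.TTheory GRing.Theory Num.Theory.
Local Open Scope ring_scope.

Section SignRegularity.
Variable R : realType.

Definition coords n (x : 'cV[R]_n) : seq R := [seq x i 0 | i <- enum 'I_n].

(* [changes s] counts the adjacent pairs of [s] with negative product: these
   are the sign changes of [s] as soon as [s] has no zero entry, the only case
   in which it is used below. *)
Definition Sminus n (x : 'cV[R]_n) : nat :=
  changes [seq a <- coords x | a != 0].

(* [fill x e] gives the value 1 ([e i] false) or -1 ([e i] true) to every zero
   entry of [x], and leaves the other entries unchanged. *)
Definition fill n (x : 'cV[R]_n) (e : {ffun 'I_n -> bool}) : 'cV[R]_n :=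
  \col_i (if x i 0 == 0 then (-1) ^+ e i else x i 0).

Definition Splus n (x : 'cV[R]_n) : nat :=
  if x == 0 then n
  else \max_(e : {ffun 'I_n -> bool}) changes (coords (fill x e)).

(* For nonzero [x]: the [i]-th entry has sign [s] in every assignment achieving
   the maximum that defines [Splus x]. *)
Definition Splus_sign n (x : 'cV[R]_n) (i : 'I_n) (s : R) : Prop :=
  forall e : {ffun 'I_n -> bool},
    changes (coords (fill x e)) = Splus x -> Num.sg (fill x e i 0) = s.

Lemma Splus_attained n (x : 'cV[R]_n) : x != 0 ->
  exists e : {ffun 'I_n -> bool}, changes (coords (fill x e)) = Splus x.
Proof.
move=> x0; rewrite /Splus (negPf x0).
have [|e ->] := @bigop.eq_bigmax _ (fun e => changes (coords (fill x e))).
  by apply/card_gt0P; exists [ffun=> true].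
by exists e.
Qed.

Lemma Splus_sign_neq0 n (x : 'cV[R]_n) (i : 'I_n) (s : R) : x i 0 != 0 ->
  Splus_sign x i s <-> Num.sg (x i 0) = s.
Proof.
move=> xi0; have fillE e : fill x e i 0 = x i 0 by rewrite mxE (negPf xi0).
split=> [H|H e _]; last by rewrite fillE.
have [|e /H] := @Splus_attained _ x; last by rewrite fillE.
by apply: contraNneq xi0 => ->; rewrite mxE.
Qed.

Definition sign_pattern k (eps : k.-tuple R) : Prop :=
  forall i : 'I_k, tnth eps i = 1 \/ tnth eps i = -1.

(* Indexing starts at 1, with the convention that the 0-th sign is 1. *)
Definition eps_at k (eps : k.-tuple R) (r : nat) : R := (1 :: eps)`_r.

(* The r x r minors of [A] are the determinants of the submatrices picked by
   strictly increasing choices [f] of r rows and [g] of r columns. *)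
Definition SSR m n k (eps : k.-tuple R) (A : 'M[R]_(m, n)) : Prop :=
  forall r : nat, (1 <= r <= k)%N ->
  forall (f : 'I_r -> 'I_m) (g : 'I_r -> 'I_n),
    {homo f : i j / (i < j)%N} -> {homo g : i j / (i < j)%N} ->
    \det (mxsub f g A) != 0 /\ Num.sg (\det (mxsub f g A)) = eps_at eps r.

End SignRegularity.

(* Main.v *)
(* Summing the columns of A over the blocks of constant sign of x0, with weights
   |x0_i|, gives a matrix B with p + 1 <= n - 1 columns, where p = S^-(x0), such
   that A x0 = B d for an alternating sign vector d; by multilinearity B inherits
   the strict sign regularity of A. If B d weakly alternated on p + 2 rows, the
   expansion of det (B d | B) = 0 on these rows along B d would force B d = 0
   there, hence d = 0. If B d weakly alternates on p + 1 rows, Cramer's rule for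
   d_0 on these rows gives the sign of d_0. *)
Require Import Defs.
From mathcomp Require Import all_boot all_order all_algebra.
From mathcomp Require Import reals.
From mathcomp.real_closed Require Import qe_rcf_th.
From mathcomp Require Import perm zify ring lra.

Set Implicit Arguments.
Unset Strict Implicit.
Unset Printing Implicit Defensive.

Import Order.TTheory GRing.Theory Num.Theory.
Local Open Scope ring_scope.

(** * Minors after summing columns over blocks *)

(* Cauchy-Binet before grouping the choices of rows by their image. *)
Lemma det_mulmx_rect (R : comNzRingType) (r n : nat)
    (M : 'M[R]_(r, n)) (C : 'M[R]_(n, r)) :
  \det (M *m C) = \sum_(h : {ffun 'I_r -> 'I_n})
    (\prod_b C (h b) b) * \det (colsub h M).
Proof.
under [RHS]eq_bigr do rewrite -det_tr big_distrr /=.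
rewrite exchange_big -det_tr /=; apply: eq_bigr => /= s _.
under eq_bigr do rewrite !mxE.
rewrite bigA_distr_bigA big_distrr /=; apply: eq_bigr => h _.
rewrite big_split /=.
have -> : \prod_b (colsub h M)^T b ((s : {perm _}) b) =
    \prod_b M ((s : {perm _}) b) (h b).
  by apply: eq_bigr => b _; rewrite !mxE.
by rewrite [RHS]mulrC mulrA.
Qed.

Lemma SSR_minor_gt0 (R : realType) (m n k : nat) (eps : k.-tuple R)
    (A : 'M[R]_(m, n)) (r : nat) (f : 'I_r -> 'I_m) (g : 'I_r -> 'I_n) :
  SSR eps A -> (r <= k)%N ->
  {homo f : i j / (i < j)%N} -> {homo g : i j / (i < j)%N} ->
  0 < eps_at eps r * \det (mxsub f g A).
Proof.
(* For [r = 0] the empty minor and the sign of index 0 are both 1; this serves vectors of constant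
   sign, where [p = 0]. *)
move=> hA; case: r f g => [|r] f g rk hf hg; first by rewrite det_mx00 mulr1.
have [|d0 <-] := hA r.+1 _ f g hf hg; first by rewrite rk.
by rewrite -normrEsg normr_gt0.
Qed.

(* Summing positively weighted columns over consecutive blocks keeps strict
   sign regularity: each minor of the result is a positive combination of
   minors of [A], one for each choice of a column in every selected block. *)
Lemma SSR_block_minor_gt0 (R : realType) (m n q k : nat) (eps : k.-tuple R)
    (A : 'M[R]_(m, n)) (w : 'I_n -> R) (c : 'I_n -> 'I_q) (s : 'I_q -> 'I_n)
    (r : nat) (f : 'I_r -> 'I_m) (g : 'I_r -> 'I_q) :
  SSR eps A -> (forall i, 0 < w i) ->
  {homo c : i j / (i <= j)%N} -> cancel s c -> (r <= k)%N ->
  {homo f : i j / (i < j)%N} -> {homo g : i j / (i < j)%N} ->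
  0 < eps_at eps r *
      \det (mxsub f g (A *m \matrix_(i, j) (w i *+ (c i == j)))).
Proof.
move=> hA w0 hc sK rk hf hg; rewrite mxsub_mul det_mulmx_rect big_distrr /=.
pose h0 := [ffun b => s (g b)].
have term_gt0 (h : {ffun 'I_r -> 'I_n}) : (forall b, c (h b) = g b) ->
    0 < eps_at eps r *
        ((\prod_b colsub g (\matrix_(i, j) (w i *+ (c i == j))) (h b) b) *
         \det (colsub h (rowsub f A))).
  move=> hE; rewrite mulrCA mulr_gt0 //.
    by apply: prodr_gt0 => b _; rewrite !mxE hE eqxx mulr1n w0.
  rewrite (_ : colsub h _ = mxsub f h A); last by apply/matrixP => a b; rewrite !mxE.
  apply: SSR_minor_gt0 => // i j ij.
  have := hg _ _ ij; rewrite -!hE !ltnNge; apply: contra; exact: hc.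
rewrite (bigD1 h0) //= ltr_wpDr //; last first.
  by apply: term_gt0 => b; rewrite ffunE sK.
apply: sumr_ge0 => h _.
have [/forallP hE|] := boolP [forall b, c (h b) == g b].
  by apply/ltW/term_gt0 => b; apply/eqP.
case/forallPn => b /negPf hb.
by rewrite (bigD1 b) //= !mxE hb mulr0n !mul0r mulr0.
Qed.

Lemma ltn_comp_lift (m n : nat) (f : 'I_n.+1 -> 'I_m) (i : 'I_n.+1) :
  {homo f : a b / (a < b)%N} -> {homo f \o lift i : a b / (a < b)%N}.
Proof. by move=> hf a b ab; apply: hf; rewrite /= ltnNge leq_bump2 -ltnNge. Qed.

(** * Weak sign alternation in the image of [B] *)

Section Alternation.
Variables (R : realFieldType) (m p : nat) (B : 'M[R]_(m, p.+1)) (e : R).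
Hypothesis Bpos : forall f : 'I_p.+1 -> 'I_m,
  {homo f : i j / (i < j)%N} -> 0 < e * \det (rowsub f B).

(** Rows of [B] picked by an increasing [f] form an invertible matrix. *)
Lemma minor_ker (d : 'cV[R]_p.+1) (f : 'I_p.+1 -> 'I_m) :
  {homo f : i j / (i < j)%N} -> (forall j, (B *m d) (f j) 0 = 0) -> d = 0.
Proof.
move=> hf Bd0.
have Bu : rowsub f B \in unitmx.
  by rewrite unitmxE unitfE; apply/eqP => d0; have := Bpos hf; rewrite d0 mulr0 ltxx.
rewrite -[d](mulKmx Bu) mul_rowsub_mx.
rewrite (_ : rowsub f (B *m d) = 0) ?mulmx0 //.
by apply/colP => j; rewrite !mxE -[RHS](Bd0 j) mxE.
Qed.

(* The columns of [M = (B d | B)], restricted to the rows of [f], are dependent,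
   while all terms in the expansion of [\det M] along [B d] have the same weak
   sign. Hence they all vanish. *)
Lemma weak_alternation_ker (d : 'cV[R]_p.+1) (f : 'I_p.+2 -> 'I_m) (t : R) :
  {homo f : i j / (i < j)%N} -> t != 0 ->
  (forall j : 'I_p.+2, 0 <= t * (-1) ^+ j * (B *m d) (f j) 0) -> d = 0.
Proof.
move=> hf t0 yge0; set y := B *m d in yge0 *.
pose M : 'M_(p.+2) := row_mx (rowsub f y) (rowsub f B).
have hfl (i : 'I_p.+2) : {homo f \o lift i : a b / (a < b)%N}.
  exact: ltn_comp_lift.
have cofE i : cofactor M i ord0 = (-1) ^+ i * \det (rowsub (f \o lift i) B).
  rewrite /cofactor addn0; congr (_ * \det _); apply/matrixP => a b.
  by rewrite !mxE; case: splitP => [j|j /= [/val_inj <-]]; rewrite ?mxE //= ord1.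
have detM : \det M = 0.
  (* [M] kills [w = (1, -d)]; since [w] has first entry 1, applying the adjugate gives
     [\det M = 0]. *)
  pose w : 'cV[R]_(1 + p.+1) := col_mx 1%:M (- d).
  have Mw : M *m w = 0.
    rewrite [LHS](mul_row_col (rowsub f y) (rowsub f B)).
    by rewrite mulmxN mulmx1 mul_rowsub_mx subrr.
  have : \adj M *m (M *m w) = 0 by rewrite Mw mulmx0.
  rewrite mulmxA mul_adj_mx mul_scalar_mx => /colP/(_ 0).
  by rewrite !mxE; case: splitP => // j _; rewrite !ord1 mxE eqxx mulr1.
have M0 i : M i ord0 = y (f i) 0.
  by rewrite !mxE; case: splitP => // j _; rewrite !mxE !ord1.
have : \sum_(i < p.+2) (t * (-1) ^+ i * y (f i) 0) *
    (e * \det (rowsub (f \o lift i) B)) = 0.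
  transitivity (t * e * \det M); last by rewrite detM mulr0.
  rewrite (expand_det_col _ ord0) big_distrr /=; apply: eq_bigr => i _.
  by rewrite M0 cofE; ring.
move/psumr_eq0P => y0.
(* The minors being nonzero, [B d] vanishes on all rows of [f]; those other than the first already
   force [d = 0]. *)
apply: (minor_ker (hfl ord0)) => j; apply/eqP.
have /eqP : (t * (-1) ^+ lift ord0 j * y (f (lift ord0 j)) 0) *
    (e * \det (rowsub (f \o lift (lift ord0 j)) B)) = 0.
  by apply: y0 => // i _; rewrite mulr_ge0 // ltW // Bpos.
by rewrite mulf_eq0 (gt_eqF (Bpos (hfl _))) orbF !mulf_eq0 signr_eq0 (negPf t0).
Qed.

(** By Cramer's rule, [\det (rowsub f B) * d_0] expands along the entries of [B d]; the cofactor
    signs match their weak alternation, so all terms agree in sign. *)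
Lemma weak_alternation_first (e' : R) (d : 'cV[R]_p.+1) (f : 'I_p.+1 -> 'I_m) (t : R) :
  (forall g : 'I_p -> 'I_m, {homo g : i j / (i < j)%N} ->
     0 < e' * \det (mxsub g (lift ord0) B)) ->
  {homo f : i j / (i < j)%N} ->
  (forall j : 'I_p.+1, 0 <= t * (-1) ^+ j * (B *m d) (f j) 0) ->
  0 <= t * e' * e * d ord0 0.
Proof.
move=> Bpos' hf yge0; set y := B *m d in yge0 *.
have hfl (i : 'I_p.+1) : {homo f \o lift i : a b / (a < b)%N}.
  exact: ltn_comp_lift.
have cramer : \det (rowsub f B) * d ord0 0 =
    \sum_(j < p.+1) (-1) ^+ j * \det (mxsub (f \o lift j) (lift ord0) B) * y (f j) 0.
  have : \adj (rowsub f B) *m rowsub f y = (\det (rowsub f B)) *: d.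
    by rewrite -mul_rowsub_mx mulmxA mul_adj_mx mul_scalar_mx.
  move/colP/(_ ord0); rewrite !mxE => <-; apply: eq_bigr => j _.
  rewrite !mxE /cofactor addn0; congr (_ * \det _ * _).
  by apply/matrixP => a b; rewrite !mxE.
rewrite -(pmulr_rge0 _ (Bpos hf)).
have -> : e * \det (rowsub f B) * (t * e' * e * d ord0 0) =
    t * e' * e ^+ 2 * (\det (rowsub f B) * d ord0 0) by ring.
rewrite cramer big_distrr /=; apply: sumr_ge0 => j _.
rewrite (_ : _ * _ = e ^+ 2 * ((t * (-1) ^+ j * y (f j) 0) *
  (e' * \det (mxsub (f \o lift j) (lift ord0) B)))); last by ring.
by rewrite mulr_ge0 ?sqr_ge0 // mulr_ge0 // ltW // Bpos'.
Qed.
End Alternation.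

(** * Sign changes and blocks of constant sign *)

Lemma changes_sum (R : rcfType) (s : seq R) :
  changes s = (\sum_(0 <= j < size s) (s`_j * s`_j.+1 < 0)%R)%N.
Proof.
elim: s => [|a s IHs]; first by rewrite big_nil.
by rewrite big_nat_recl //= IHs nth0.
Qed.

Section SignBlocks.
Variable R : realType.

Lemma coords_nth (n : nat) (v : 'cV[R]_n) (i : 'I_n) : (coords v)`_i = v i 0.
Proof. by rewrite (nth_map i) ?size_enum_ord // nth_ord_enum. Qed.

Lemma size_coords (n : nat) (v : 'cV[R]_n) : size (coords v) = n.
Proof. by rewrite size_map size_enum_ord. Qed.

Lemma changes_coords (n : nat) (v : 'cV[R]_n.+1) :
  changes (coords v) =
  (\sum_(0 <= j < n) ((coords v)`_j * (coords v)`_j.+1 < 0)%R)%N.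
Proof.
(* The last term reads the default value 0 past the end, so it counts no change. *)
rewrite changes_sum size_coords big_nat_recr //= [(coords v)`_n.+1]nth_default.
  by rewrite mulr0 ltxx addn0.
by rewrite size_coords.
Qed.

Lemma changes_coords_lt (n : nat) (v : 'cV[R]_n.+1) (i j : 'I_n.+1) :
  j = i.+1 :> nat -> Num.sg (v i 0) = Num.sg (v j 0) ->
  (changes (coords v) < n)%N.
Proof.
move=> ij sgij; have lt_in : (i < n)%N by rewrite -ltnS -ij.
rewrite changes_coords big_mkord (bigD1 (Ordinal lt_in)) //=.
rewrite -ij !coords_nth -sgr_lt0 sgrM -sgij -expr2 ltNge sqr_ge0 add0n.
rewrite -[ltnRHS]card_ord (cardD1 (Ordinal lt_in)) /= ltnS -sum1_card.
rewrite [leqRHS](eq_bigl (fun k => k != Ordinal lt_in)) => [|k].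
  by apply: leq_sum => k _; apply: leq_b1.
by rewrite !inE andbT.
Qed.

(* [c i] is the index of the block of consecutive entries of constant sign
   containing the [i]-th entry, and [s] picks an entry in every block. *)
Lemma sign_blocks (n q : nat) (v : 'cV[R]_n.+1) :
  changes (coords v) = q -> (forall i, v i 0 != 0) ->
  exists (c : 'I_n.+1 -> 'I_q.+1) (s : 'I_q.+1 -> 'I_n.+1),
    [/\ {homo c : i j / (i <= j)%N}, cancel s c,
        c ord0 = 0%N :> nat, c ord_max = q :> nat &
        forall i, Num.sg (v i 0) = (-1) ^+ c i * Num.sg (v ord0 0)].
Proof.
rewrite changes_coords => chq v0.
pose b j : nat := (coords v)`_j * (coords v)`_j.+1 < 0.
pose ch i := (\sum_(0 <= j < i) b j)%N.
have chS i : ch i.+1 = (ch i + b i)%N by rewrite /ch big_nat_recr.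
have ch0 : ch 0%N = 0%N by rewrite /ch big_nil.
have chmono : {homo ch : i j / (i <= j)%N}.
  by apply: homo_leq leqnn leq_trans _ => i; rewrite chS leq_addr.
(* Discrete intermediate values: [ch] starts at 0 and grows by at most 1 per step. *)
have chsurj i k : (k <= ch i)%N -> exists2 j, (j <= i)%N & ch j = k.
  elim: i => [|i IHi] ki; first by exists 0%N => //; move: ki; rewrite ch0; lia.
  have [/IHi[j ji <-]|lt_k] := leqP k (ch i); first by exists j; rewrite // ltnW.
  exists i.+1 => //; apply/eqP; rewrite eqn_leq ki andbT.
  by rewrite chS; apply: leq_trans lt_k; rewrite -addn1 leq_add2l leq_b1.
have chle (i : 'I_n.+1) : (ch i < q.+1)%N.
  by rewrite ltnS -chq; apply: chmono; rewrite -ltnS.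
pose c i := Ordinal (chle i).
have /fin_all_exists[s sK] (k : 'I_q.+1) : exists i, c i = k.
  have [|j jn jk] := chsurj n k; first by rewrite /ch chq -ltnS.
  by exists (inord j); apply: val_inj; rewrite /= inordK.
exists c, s; split=> //= [i j|]; first exact: chmono.
have sg_nth i : (i <= n)%N ->
    Num.sg (coords v)`_i = (-1) ^+ ch i * Num.sg (coords v)`_0.
  elim: i => [|i IHi] ltin; first by rewrite ch0 mul1r.
  have nz k : (k <= n)%N -> (coords v)`_k != 0.
    by move=> kn; have := v0 (inord k); rewrite -coords_nth inordK.
  rewrite chS addnC exprD -mulrA -IHi ?(ltnW ltin) // neqr0_sign; last first.
    by rewrite mulf_neq0 ?nz // ltnW.
  rewrite sgrM mulrC mulrA -expr2.
  by rewrite sqr_sg nz ?mul1r // ltnW.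
by move=> i; rewrite -!coords_nth sg_nth // -ltnS.
Qed.

Lemma ltn_section (m n : nat) (c : 'I_n -> 'I_m) (s : 'I_m -> 'I_n) :
  {homo c : i j / (i <= j)%N} -> cancel s c -> {homo s : i j / (i < j)%N}.
Proof. by move=> hc sK i j; rewrite !ltnNge; apply: contra => /hc; rewrite !sK. Qed.

Lemma fill_neq0 (n : nat) (y : 'cV[R]_n) (e : {ffun 'I_n -> bool}) (i : 'I_n) :
  fill y e i 0 != 0.
Proof. by rewrite mxE; have [_|//] := eqVneq (y i 0) 0; rewrite signr_eq0. Qed.

(** One row is taken in each of the first [q + 1] sign blocks of the filled vector. For [y] the
    alternation is only weak, as its zero entries remain zero. *)
Lemma fill_alternation (n q : nat) (y : 'cV[R]_n.+1)
    (e : {ffun 'I_n.+1 -> bool}) : (q <= changes (coords (fill y e)))%N ->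
  exists2 f : 'I_q.+1 -> 'I_n.+1, {homo f : i j / (i < j)%N} &
    forall j : 'I_q.+1,
      0 <= Num.sg (fill y e ord0 0) * (-1) ^+ j * y (f j) 0.
Proof.
rewrite -ltnS => leq1; have [c [s [hc sK _ _ sgE]]] := sign_blocks erefl (fill_neq0 y e).
exists (s \o widen_ord leq1) => [i j ij|j]; first exact: (ltn_section hc sK).
have := sgE (s (widen_ord leq1 j)); rewrite sK /= mulrC => <-.
rewrite mxE; case: eqP => [->|_]; first by rewrite mulr0.
by rewrite -normrEsg.
Qed.

End SignBlocks.

(** * The bound and the signs of the end components *)

Lemma sg_sign (R : realDomainType) (a : R) :
  a != 0 -> Num.sg a = 1 \/ Num.sg a = -1.
Proof. by case: sgrP => // _ _; [left|right]. Qed.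

Lemma eps_at_sign (R : realType) (k : nat) (eps : k.-tuple R) (r : nat) :
  sign_pattern eps -> (r <= k)%N -> eps_at eps r = 1 \/ eps_at eps r = -1.
Proof.
case: r => [|r] heps rk; first by left.
by have := heps (Ordinal rk); rewrite (tnth_nth 0).
Qed.

Theorem theorem2p2 (R : realType) (n : nat) (hn : (0 < n)%N)
    (eps : (n.-1).-tuple R) (heps : sign_pattern eps)
    (A : 'M[R]_n) (hA : SSR eps A) :
  forall x0 : 'cV[R]_n,
    (forall i : 'I_n, x0 i 0 != 0) ->
    (exists i j : 'I_n,
       j = i.+1 :> nat /\ Num.sg (x0 i 0) = Num.sg (x0 j 0)) ->
    (Splus (A *m x0) <= Sminus x0)%N /\
    (forall r : nat, (r.+2 <= n)%N ->
       A *m x0 != 0 -> Splus (A *m x0) = r -> Sminus x0 = r ->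
       forall i : 'I_n, (i = 0%N :> nat \/ i = n.-1 :> nat) ->
         Splus_sign (A *m x0) i
           (eps_at eps r * eps_at eps r.+1 * Num.sg (x0 i 0))).
Proof.
case: n hn eps heps A hA => // n _ eps heps A hA x x_neq0 [i0 [j0 [ij0 sgij0]]].
have SminusE : Sminus x = changes (coords x).
  rewrite /Sminus; congr changes; apply/all_filterP/allP => a /mapP[i _ ->] //.
(* The two successive equal signs give [p + 1 <= n], so [eps] prescribes the sign of minors of order
   [p + 1]. *)
have lt_pn := changes_coords_lt ij0 sgij0; rewrite -SminusE in lt_pn.
set p := Sminus x in SminusE lt_pn *.
have [c [s [hc sK c0 cmax sgx]]] := sign_blocks (esym SminusE) x_neq0.
pose w i := `|x i 0|.
have w0 i : 0 < w i by rewrite normr_gt0.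
pose B := A *m \matrix_(i, j) (w i *+ (c i == j)).
pose d : 'cV[R]_p.+1 := \col_k ((-1) ^+ k * Num.sg (x ord0 0)).
have sgx0 : Num.sg (x ord0 0) != 0 by rewrite sgr_eq0.
have d0 : d != 0.
  apply: contraNneq sgx0 => /colP/(_ ord0).
  by rewrite !mxE expr0 mul1r => ->.
have yE : A *m x = B *m d.
  rewrite -mulmxA; congr (_ *m _); apply/colP => i.
  rewrite !mxE (bigD1 (c i)) //= big1 => [|k /negPf ki]; last first.
    by rewrite !mxE eq_sym ki mul0r.
  by rewrite !mxE eqxx addr0 mulr1n -sgx mulrC mulr_sg_norm.
have Bpos (f : 'I_p.+1 -> 'I_n.+1) : {homo f : i j / (i < j)%N} ->
    0 < eps_at eps p.+1 * \det (rowsub f B).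
  by move=> hf; apply: (SSR_block_minor_gt0 (s := s)).
have Bpos' (f : 'I_p -> 'I_n.+1) : {homo f : i j / (i < j)%N} ->
    0 < eps_at eps p * \det (mxsub f (lift ord0) B).
  move=> hf; apply: (SSR_block_minor_gt0 (s := s)) => //.
  exact: ltnW.
(* Hence [Splus] is here the maximum over fillings, not the conventional value at 0. *)
have y0 : A *m x != 0.
  apply: contraNneq d0 => y0.
  apply/eqP/(minor_ker Bpos (f := widen_ord (ltnW lt_pn : (p.+1 <= n.+1)%N))) => // j.
  by rewrite -yE y0 mxE.
split=> [|r _ _ SplusE pr i i_end e eE].
  rewrite /Splus (negPf y0); apply/bigmax_leqP => e _; rewrite leqNgt.
  apply/negP => /fill_alternation[f hf yge0].
  case/eqP: d0; rewrite yE in yge0.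
  by apply: (weak_alternation_ker Bpos hf _ yge0); rewrite sgr_eq0 fill_neq0.
rewrite {}SplusE in eE; rewrite -{r}pr in eE *.
have [|f hf yge0] := @fill_alternation _ n p (A *m x) e; first by rewrite eE.
(* [x] and the filled vector both have [p] changes, so their end entries lie in blocks of equal
   index, 0 or [p]. This reduces the last component to the first. *)
have [c' [s' [_ _ c'0 c'max sgy]]] := sign_blocks eE (fill_neq0 _ e).
have cE : c' i = c i :> nat.
  case: i_end => iE; first by rewrite (_ : i = ord0) ?c0 //; apply: val_inj.
  by rewrite (_ : i = ord_max) ?cmax //; apply: val_inj.
rewrite sgy sgx cE mulrCA; congr (_ * _).
set t := Num.sg (fill _ _ _ _) in yge0 *.
have t_sign : t = 1 \/ t = -1 by apply/sg_sign/fill_neq0.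
rewrite yE in yge0.
have := weak_alternation_first Bpos Bpos' hf yge0.
rewrite mxE expr0 mul1r.
(* All factors are 1 or -1, so a nonnegative product equals 1, which determines [t]. *)
have [->|->] := t_sign; have [->|->] := sg_sign (x_neq0 ord0);
  have [->|->] := eps_at_sign heps (ltnW lt_pn);
  have [->|->] := eps_at_sign heps lt_pn; lra.
Qed.
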